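(* Let $n\ge 4$ be an integer, and let $\phi_n$ be the continuous function, whose existence was proved by Götze and Zaporozhets, such that $$\sup_{-\infty\le a<b\le\infty}\left|\mathbb{P}\left\{a\le\frac{D(P)}{Q^{2n-2}}\le b\right\}-\int_a^b\phi_n(x)\,dx\right|\ll_n\frac{1}{\log Q},$$ where the polynomial $P$ is picked at random uniformly from $\mathcal{P}_n(Q)$. Then the difference on the left-hand side can be estimated by $C_n/Q$ instead of $C_n/\log Q$, that is, $$\sup_{-\infty\le a<b\le\infty}\left|\mathbb{P}\left\{a\le\frac{D(P)}{Q^{2n-2}}\le b\right\}-\int_a^b\phi_n(x)\,dx\right|\le\frac{C_n}{Q},$$ where the constant $C_n$ depends on $n$ only.
   Context: For $P(x)=\sum_{k=0}^n a_kx^k=a_n\prod_{j=1}^n(x-\alpha_j)$ of degree $n$, the discriminant is $D(P)=a_n^{2n-2}\prod_{1\le i<j\le n}(\alpha_i-\alpha_j)^2$. $\mathcal{P}_n(Q)$ is the set of all integer polynomials of degree $n$ with naive height $\max_{0\le k\le n}|a_k|\le Q$. $\mathbb{P}\{A\}$ denotes the probability of an event $A$. The degree $n$ is fixed and $Q$ grows to infinity; $\ll_n$ denotes inequality up to a positive constant factor depending on $n$ only. *)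

(* Defs.v *)
From HB Require Import structures.
From mathcomp Require Import all_boot all_order all_fingroup all_algebra.
From mathcomp Require Import complex finmap zify.
From mathcomp Require Import all_classical all_reals all_analysis.

Set Implicit Arguments.
Unset Strict Implicit.
Unset Printing Implicit Defensive.

Import Order.TTheory GRing.Theory Num.Theory.
Import numFieldNormedType.Exports.

Local Open Scope fset_scope.
Local Open Scope classical_set_scope.
Local Open Scope ring_scope.

(* The roots of P in R[i], listed with multiplicity in an arbitrary order. *)
Definition croots (R : realType) (P : {poly int}) : seq R[i] :=
  sval (closed_field_poly_normal (map_poly intr P : {poly R[i]})).

Definition prod_sqr_diff (K : comPzRingType) (s : seq K) : K :=
  \prod_(i < size s) \prod_(j < size s | (i < j)%N) (s`_i - s`_j) ^+ 2.

(* The subtraction in the exponent is truncated: it is exact for polynomials of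
   degree at least 1. *)
Definition discriminantC (R : realType) (P : {poly int}) : R[i] :=
  (lead_coef P)%:~R ^+ (2 * (size P).-1 - 2) * prod_sqr_diff (croots R P).

(* Nothing is lost by taking the real part: see discriminantC_real. *)
Definition discriminant (R : realType) (P : {poly int}) : R :=
  complex.Re (discriminantC R P).

Definition intpolys (R : realType) (n : nat) (Q : R) : set {poly int} :=
  [set P | size P = n.+1 /\ forall k, (k <= n)%N -> `|P`_k|%:~R <= Q].

(* [fset_set] enumerates finite sets only: see finite_intpolys. *)
Definition prob_intpolys (R : realType) (n : nat) (Q : R)
    (A : set {poly int}) : R :=
  #|` fset_set (intpolys n Q `&` A)|%:R / #|` fset_set (intpolys n Q)|%:R.

(* The integral is extended-real valued, with +oo - oo = -oo; hence the
   supremum below can only be finite if phi is integrable on the whole line. *)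
Definition discriminant_discrepancy (R : realType) (n : nat) (phi : R -> R)
    (Q : R) : \bar R :=
  ereal_sup [set d : \bar R | exists a b : \bar R, (a < b)%E /\
    d = `| (prob_intpolys n Q
              [set P | (a <= (discriminant R P / Q ^+ (2 * n - 2))%:E <= b)%E])%:E
           - \int[lebesgue_measure]_(x in [set x : R | (a <= x%:E <= b)%E])
               (phi x)%:E |%E].

Section Sanity.
Variable R : realType.

Lemma prod_sqr_diff_det (K : comPzRingType) (s : seq K) :
  prod_sqr_diff s =
  (\det (Vandermonde (size s) (\row_(i < size s) s`_i))) ^+ 2.
Proof.
rewrite det_Vandermonde /prod_sqr_diff -prodrXl; apply: eq_bigr => i _.
rewrite -prodrXl; apply: eq_bigr => j _.
by rewrite !mxE -sqrrN opprB.
Qed.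

Lemma perm_prod_sqr_diff (K : comPzRingType) (s t : seq K) :
  perm_eq s t -> prod_sqr_diff s = prod_sqr_diff t.
Proof.
move=> st; have /tuple_permP[p ->] : perm_eq s (in_tuple t) by [].
set u := [tuple _ | _ < _].
rewrite /prod_sqr_diff size_tuple.
pose a := \row_(i < size t) t`_i.
have -> : \prod_(i < size t) \prod_(j < size t | (i < j)%N) (u`_i - u`_j) ^+ 2
    = (\det (Vandermonde (size t) (\row_i u`_i))) ^+ 2.
  rewrite det_Vandermonde -prodrXl; apply: eq_bigr => i _.
  rewrite -prodrXl; apply: eq_bigr => j _.
  by rewrite !mxE -sqrrN opprB.
have -> : Vandermonde (size t) (\row_i u`_i) = col_perm p (Vandermonde (size t) a).
  by apply/matrixP => i j; rewrite !mxE -tnth_nth tnth_mktuple (tnth_nth 0).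
rewrite col_permE det_mulmx det_perm exprMn sqrr_sign mulr1.
exact: esym (prod_sqr_diff_det t).
Qed.

Lemma crootsE (P : {poly int}) :
  map_poly intr P = (lead_coef P)%:~R *: \prod_(z <- croots R P) ('X - z%:P).
Proof.
rewrite /croots; case: closed_field_poly_normal => r /= {1}->.
by rewrite lead_coef_map_inj //; exact: intr_inj.
Qed.

Lemma size_croots (P : {poly int}) : P != 0 -> size (croots R P) = (size P).-1.
Proof.
move=> P0; have l0 : (lead_coef P)%:~R != 0 :> R[i].
  by rewrite intr_eq0 lead_coef_eq0.
have /(congr1 (fun p : {poly R[i]} => size p)) := crootsE P.
by rewrite size_scale// size_prod_XsubC size_map_inj_poly// => [->//|]; exact: intr_inj.
Qed.

Lemma discriminantC_roots (P : {poly int}) (s : seq R[i]) : P != 0 ->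
  map_poly intr P = (lead_coef P)%:~R *: \prod_(z <- s) ('X - z%:P) ->
  discriminantC R P =
  (lead_coef P)%:~R ^+ (2 * (size P).-1 - 2) * prod_sqr_diff s.
Proof.
move=> P0 Ps; congr (_ * _); apply: perm_prod_sqr_diff; apply: prod_XsubC_eq.
have l0 : (lead_coef P)%:~R != 0 :> R[i] by rewrite intr_eq0 lead_coef_eq0.
by apply: (scalerI l0); rewrite -crootsE.
Qed.

Lemma discriminantC_real (P : {poly int}) : P != 0 ->
  discriminantC R P = (discriminant R P)%:C%C.
Proof.
move=> P0; pose f : {rmorphism R[i] -> R[i]} := @conjc R.
suff /eqP : f (discriminantC R P) = discriminantC R P.
  rewrite /f/= /discriminant; case: (discriminantC R P) => x y /=.
  by rewrite eq_complex /= eqxx /= eqNr => /eqP ->.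
rewrite [RHS](@discriminantC_roots P (map f (croots R P)))//.
  rewrite rmorphM rmorphXn rmorph_int; congr (_ * _).
  rewrite /prod_sqr_diff size_map rmorph_prod; apply: eq_bigr => i _.
  rewrite rmorph_prod; apply: eq_bigr => j _.
  by rewrite rmorphXn rmorphB !(nth_map 0).
rewrite big_map.
have -> : \prod_(j <- croots R P) ('X - (f j)%:P) =
          map_poly f (\prod_(j <- croots R P) ('X - j%:P)).
  by rewrite rmorph_prod; apply: eq_bigr => z _; rewrite rmorphB /= map_polyX map_polyC.
rewrite -[(lead_coef P)%:~R](rmorph_int f) -map_polyZ -crootsE.
by apply/polyP => k; rewrite !coef_map /= ?rmorph_int.
Qed.

Lemma finite_intpolys (n : nat) (Q : R) : finite_set (intpolys n Q).
Proof.
pose N := `|Num.floor Q|%N.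
pose g (c : {ffun 'I_n.+1 -> 'I_(2 * N).+1}) : {poly int} :=
  \poly_(i < n.+1) ((c (inord i))%:Z - N%:Z).
apply: (@sub_finite_set _ _ (g @` setT)); last first.
  by apply: finite_image; exact: finite_finset.
move=> P [sP hP].
have hN k : (k <= n)%N -> (absz (P`_k)%R <= N)%N.
  move=> /hP; rewrite -floor_ge_int => h.
  have N0 : 0 <= Num.floor Q := le_trans (normr_ge0 _) h.
  by rewrite -lez_nat abszE (le_trans h)// /N abszE ger0_norm.
exists [ffun i : 'I_n.+1 => inord (absz (P`_i + N%:Z)%R)] => //.
apply/polyP => k; rewrite coef_poly; case: ltnP => kn; last first.
  by rewrite nth_default // sP.
have kE : (inord k : 'I_n.+1) = k :> nat by rewrite inordK.
have hk := hN k kn; rewrite ffunE kE inordK; last by lia.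
by lia.
Qed.

End Sanity.

(* Main.v *)
Require Import Defs.
From HB Require Import structures.
From mathcomp Require Import all_boot all_order all_fingroup all_algebra.
From mathcomp Require Import complex finmap zify ring lra.
From mathcomp Require Import all_classical all_reals all_analysis.
Import Order.TTheory GRing.Theory Num.Theory.
Import numFieldNormedType.Exports.
Set Implicit Arguments.
Unset Strict Implicit.
Unset Printing Implicit Defensive.
Local Open Scope ring_scope.

(** The limit law is never computed.  For an integer [m > 0] the probabilities
    at heights [Q] and [m Q] differ by [O(1/Q)], uniformly in [m] and in the
    interval; letting [m] go to infinity, the assumed [O(1 / log (m Q))] bound
    replaces the probability at height [m Q] by the integral of [phi].

    By homogeneity of the discriminant, the polynomials of height at most [Q]
    are the points of [m Z^(n+1)] among those of height at most [m Q].  We pass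
    from [Z^(n+1)] to [m Z^(n+1)] one coordinate at a time.  On a line parallel
    to an axis, [a_n ^ (2 n^2) D(P)] is a polynomial of bounded degree, so the
    indicator function of the event has bounded total variation there, and
    thinning the line by the factor [m] costs [O(m)] points.  The bounded degree
    comes from [D = a_n ^ (2n - 2) det (s_(i+j))], with [s_k] the power sums of
    the roots, since by Newton's identities [a_n ^ k s_k] is a polynomial in the
    coefficients. *)

(** * Total variation of sequences and thinning of a line by the factor [m] *)

Section Variation.
Variable R : realType.
Implicit Types H G : nat -> R.

Lemma sum_shift H a b :
  \sum_(a <= i < a + b) H i = \sum_(0 <= i < b) H (a + i)%N.
Proof.
rewrite -{1}[a]add0n big_addn addKn; by apply: eq_bigr => i _; rewrite addnC.
Qed.

Definition seq_variation H (M : nat) : R := \sum_(0 <= i < M) `|H i.+1 - H i|.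

Lemma seq_variation_ge0 H M : 0 <= seq_variation H M.
Proof. by apply: sumr_ge0. Qed.

Lemma seq_variationD H M N :
  seq_variation H (M + N) = seq_variation H M + seq_variation (fun i => H (M + i)%N) N.
Proof.
rewrite /seq_variation (big_cat_nat (n := M)) ?leq_addr//=; congr (_ + _).
by rewrite sum_shift; apply: eq_bigr => i _; rewrite addnS.
Qed.

Lemma dist_le_seq_variation H M r : (r <= M)%N -> `|H r - H 0%N| <= seq_variation H M.
Proof.
move=> rM; apply: (@le_trans _ _ (seq_variation H r)).
  rewrite -(telescope_sumr H (leq0n r)); exact: ler_norm_sum.
by rewrite -(subnKC rM) seq_variationD lerDl seq_variation_ge0.
Qed.

(** A discrete Leibniz rule: both factors lie in [[0, 1]], so each increment of the product is
    bounded by the sum of the two increments. It controls the indicator of a conjunction. *)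
Lemma seq_variationM H G M :
  (forall i, 0 <= H i <= 1) -> (forall i, 0 <= G i <= 1) ->
  seq_variation (fun i => H i * G i) M <= seq_variation H M + seq_variation G M.
Proof.
move=> H01 G01; rewrite /seq_variation -big_split /=; apply: ler_sum => i _.
have -> : H i.+1 * G i.+1 - H i * G i =
    (H i.+1 - H i) * G i.+1 + H i * (G i.+1 - G i) by ring.
apply: le_trans (ler_normD _ _) _; rewrite !normrM.
have /andP[h0 h1] := H01 i; have /andP[g0 g1] := G01 i.+1.
by apply: lerD; [rewrite ler_piMr// ger0_norm | rewrite ler_piMl// ger0_norm].
Qed.

(** Each term differs from the first term of its block of length [m] by at most the variation inside
    the block; a block has [m] terms, and the variations of the blocks add up. *)
Lemma sum_blocks H m K :
  `|\sum_(0 <= i < m * K) H i - m%:R * \sum_(0 <= k < K) H (m * k)%N|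
    <= m%:R * seq_variation H (m * K).
Proof.
elim: K => [|K IH].
  by rewrite muln0 !big_nil mulr0 subrr normr0 mulr_ge0// seq_variation_ge0.
rewrite mulnS addnC seq_variationD mulrDr big_nat_recr//=.
rewrite (big_cat_nat (n := (m * K)%N)) ?leq_addr//=.
rewrite (sum_shift H (m * K)%N m).
set S := \sum_(0 <= i < m * K) _; set S1 := \sum_(0 <= k < K) _.
set S2 := \sum_(0 <= i < m) _.
have -> : S + S2 - m%:R * (S1 + H (m * K)%N) =
  (S - m%:R * S1) + (S2 - m%:R * H (m * K)%N) by ring.
apply: le_trans (ler_normD _ _) _; apply: lerD => //.
have -> : S2 - m%:R * H (m * K)%N =
   \sum_(0 <= i < m) (H (m * K + i)%N - H (m * K + 0)%N).
  rewrite sumrB /S2; congr (_ - _).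
  by rewrite sumr_const_nat subn0 addn0 mulr_natl.
apply: le_trans (ler_norm_sum _ _ _) _.
rewrite mulr_natl -[X in _ *+ X]subn0 -sumr_const_nat; apply: ler_sum_nat => i /andP[_ im].
exact: (@dist_le_seq_variation (fun i => H (m * K + i)%N)) (ltnW im).
Qed.

Definition ints (L : nat) : seq int := [seq i%:Z - L%:Z | i <- iota 0 (2 * L).+1].

Lemma mem_ints L (x : int) : (x \in ints L) = (`|x| <= L%:Z).
Proof.
apply/mapP/idP => [[i + ->]|xL]; first by rewrite mem_iota; lia.
by exists (absz (x + L%:Z)); rewrite ?mem_iota; lia.
Qed.

Lemma ints_uniq L : uniq (ints L).
Proof. by rewrite map_inj_uniq ?iota_uniq// => i j; lia. Qed.

Lemma sum_ints L (g : int -> R) :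
  \sum_(t <- ints L) g t = \sum_(0 <= i < (2 * L).+1) g (i%:Z - L%:Z).
Proof. by rewrite big_map. Qed.

Lemma sum_indic_bound G a b : (forall i, 0 <= G i <= 1) ->
  0 <= \sum_(a <= i < b) G i <= (b - a)%:R.
Proof.
move=> G01; apply/andP; split; first by apply: sumr_ge0 => i _; case/andP: (G01 i).
rewrite -[_%:R](@sumr_const_nat R b a 1); apply: ler_sum => i _; by case/andP: (G01 i).
Qed.

(** The first two hypotheses say that [L] is the integer part of [L' / m], so the points [m s] with
    [|s| <= L] are exactly the multiples of [m] in [[-L', L']]. They serve as the left ends of the
    blocks of [sum_blocks]. *)
Lemma sum_ints_coarse (m L L' : nat) (g : int -> R) (K : R) :
  (m * L <= L')%N -> (L' < m * L.+1)%N ->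
  (forall t, 0 <= g t <= 1) ->
  (forall (t : int) M, seq_variation (fun i => g (t + i%:Z)) M <= K) ->
  `|\sum_(t <- ints L') g t - m%:R * \sum_(s <- ints L) g (m%:Z * s)|
     <= m%:R * (K + 3%:R).
Proof.
move=> mL Lm g01 gK.
pose rho := (L' - m * L)%N.
pose G i := g (i%:Z - L'%:Z).
pose H i := G (rho + i)%N.
have G01 i : 0 <= G i <= 1 := g01 _.
rewrite !sum_ints.
have -> : \sum_(0 <= i < (2 * L).+1) g (m%:Z * (i%:Z - L%:Z)) =
    \sum_(0 <= k < (2 * L).+1) H (m * k)%N.
  by apply: eq_bigr => i _; rewrite /H /G /rho; congr g; lia.
have := sum_blocks H m (2 * L).+1.
set B := \sum_(0 <= i < m * _) _; set T := \sum_(0 <= k < (2 * L).+1) _.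
set V := seq_variation _ _ => hB.
have VK : V <= K.
  rewrite /V (_ : seq_variation H _ = seq_variation (fun i => g (rho%:Z - L'%:Z + i%:Z))
    (m * (2 * L).+1)%N) ?gK//.
  rewrite /seq_variation; apply: eq_bigr => i _; rewrite /H /G.
  by rewrite !(_ : forall k, (rho + k)%N%:Z - L'%:Z = rho%:Z - L'%:Z + k%:Z) // => k; lia.
have B' : B = \sum_(rho <= i < rho + m * (2 * L).+1) G i.
  by rewrite sum_shift.
(* The blocks fill [[-mL, mL + m - 1]]: they miss the first [rho] points of [[-L', L']] and
   overshoot its right end. Both errors involve fewer than [m] terms. *)
have E : \sum_(0 <= i < (2 * L').+1) G i = \sum_(0 <= i < rho) G i + B -
   \sum_((2 * L').+1 <= i < rho + m * (2 * L).+1) G i.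
  rewrite B' -big_cat_nat//=; last by lia.
  by rewrite [X in _ = X - _](big_cat_nat (n := (2 * L').+1))//=; [rewrite addrK|lia].
have /andP[a0 a1] := sum_indic_bound 0 rho G01.
have /andP[b0 b1] := sum_indic_bound (2 * L').+1 (rho + m * (2 * L).+1) G01.
have r1 : (rho - 0)%:R <= m%:R :> R by rewrite ler_nat; lia.
have r2 : (rho + m * (2 * L).+1 - (2 * L').+1)%:R <= m%:R :> R by rewrite ler_nat; lia.
have mV : m%:R * V <= m%:R * K by rewrite ler_wpM2l.
have m0 : 0 <= m%:R :> R by [].
move: hB; rewrite E; rewrite !ler_norml; move: a0 a1 b0 b1 r1 r2 mV m0.
set c1 := (rho - 0)%:R; set c2 := (_ - _)%:R.
move=> *; apply/andP; split; lra.
Qed.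

(** * Sums over boxes of integer vectors, one coordinate at a time *)

Fixpoint lists (r : seq int) (k : nat) : seq (seq int) :=
  if k is k'.+1 then [seq t :: s | t <- r, s <- lists r k'] else [:: [::]].

Lemma mem_lists r k s : (s \in lists r k) = (size s == k) && all (mem r) s.
Proof.
elim: k s => [|k IH] s /=; first by case: s.
apply/allpairsP/idP => [[[t s'] /= [tr + ->]]|].
  by rewrite IH /= eqSS tr /=.
case: s => [|t s] //=; rewrite eqSS => /and3P[ks tr sr].
by exists (t, s); rewrite IH ks sr.
Qed.

Lemma lists_uniq r k : uniq r -> uniq (lists r k).
Proof.
move=> ur; elim: k => [//|k IH] /=.
by apply: allpairs_uniq => // -[t s] [t' s'] _ _ [-> ->].
Qed.

Lemma map_lists (f : int -> int) r k :
  lists (map f r) k = map (map f) (lists r k).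
Proof.
elim: k => [//|k IH] /=.
rewrite IH; move: (lists r k) => l; elim: r {IH} => [//|t r IHr] /=; rewrite map_cat -IHr -!map_comp.
by congr (_ ++ _).
Qed.

Lemma sum_listsS r k (g : seq int -> R) :
  \sum_(s <- lists r k.+1) g s = \sum_(t <- r) \sum_(s <- lists r k) g (t :: s).
Proof. exact: big_allpairs_dep. Qed.

(** The weight [c] is paid once per coordinate. With [c = m] on the multiples of [m], it makes up
    for the thinning of the lattice. *)
Definition list_sum (c : R) (r : seq int) (k : nat) (g : seq int -> R) : R :=
  c ^+ k * \sum_(s <- lists r k) g s.

Lemma list_sum0 c r g : list_sum c r 0 g = g [::].
Proof. by rewrite /list_sum big_seq1 mul1r. Qed.

Lemma list_sumS c r k g : list_sum c r k.+1 g =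
  c * \sum_(t <- r) list_sum c r k (fun s => g (t :: s)).
Proof.
by rewrite /list_sum sum_listsS exprS -mulrA; congr (_ * _); rewrite -mulr_sumr.
Qed.

Lemma list_sum_le c r k g (E W : R) : 0 <= c -> 0 <= E -> c * (size r)%:R <= W ->
  (forall s, size s = k -> `|g s| <= E) -> `|list_sum c r k g| <= W ^+ k * E.
Proof.
move=> c0 E0 cW; elim: k g => [|k IH] g gE; first by rewrite list_sum0 mul1r gE.
rewrite list_sumS normrM ger0_norm//.
have W0 : 0 <= W by apply: le_trans cW; rewrite mulr_ge0.
apply: le_trans (_ : c * (W ^+ k * E *+ size r) <= _).
  rewrite ler_wpM2l//; apply: le_trans (ler_norm_sum _ _ _) _.
  rewrite -sum1_size -sumrMnr /= ; apply: ler_sum => t _.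
  by apply: IH => s sk; apply: gE; rewrite /= sk.
rewrite -mulr_natl (_ : W ^+ k.+1 * E = W * (W ^+ k * E)); last by rewrite exprS mulrA.
by rewrite [c * _]mulrA ler_wpM2r// mulr_ge0// exprn_ge0.
Qed.

(** A hybrid argument: the [k] coordinates pass from [r1] to [r2] one after another. Each
    replacement costs [E] on a line, and the other [k - 1] coordinates contribute a weighted factor
    of at most [W] each. *)
Lemma list_sum_dist c1 r1 c2 r2 k g (E W : R) :
  0 <= c1 -> 0 <= c2 -> 0 <= E ->
  c1 * (size r1)%:R <= W -> c2 * (size r2)%:R <= W ->
  (forall s1 s2, (size s1 + size s2).+1 = k ->
     `|c1 * \sum_(t <- r1) g (s1 ++ t :: s2)
        - c2 * \sum_(t <- r2) g (s1 ++ t :: s2)| <= E) ->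
  `|list_sum c1 r1 k g - list_sum c2 r2 k g| <= k%:R * W ^+ k.-1 * E.
Proof.
move=> c10 c20 E0 W1 W2; elim: k g => [|k IH] g gE.
  by rewrite !list_sum0 subrr normr0 !mul0r.
have W0 : 0 <= W by apply: le_trans W1; rewrite mulr_ge0.
rewrite !list_sumS.
set A1 := \sum_(t <- r1) _.
(* The hybrid sum: first coordinate still in [r1], the others already in [r2]. *)
pose A12 := \sum_(t <- r1) list_sum c2 r2 k (fun s => g (t :: s)).
set A2 := \sum_(t <- r2) _.
have -> : c1 * A1 - c2 * A2 = c1 * (A1 - A12) + (c1 * A12 - c2 * A2) by ring.
apply: le_trans (ler_normD _ _) _; rewrite -natr1 mulrDl mulrDl mul1r /=.
apply: lerD.
  rewrite normrM ger0_norm// /A1 /A12 -sumrB.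
  apply: le_trans (_ : c1 * ((k%:R * W ^+ k.-1 * E) *+ size r1) <= _).
    rewrite ler_wpM2l//; apply: le_trans (ler_norm_sum _ _ _) _.
    rewrite -sum1_size -sumrMnr /= ; apply: ler_sum => t _.
    by apply: IH => s1 s2 sk; apply: (gE (t :: s1) s2); rewrite /= -sk.
  (* For [k = 0] the truncated exponent [k.-1] is harmless, because the factor [k%:R] vanishes. *)
  case: k {IH A1 A12 A2 gE} => [|k] /=; first by rewrite !mul0r mul0rn mulr0.
  rewrite -mulr_natl [c1 * _]mulrA.
  rewrite (_ : k.+1%:R * W ^+ k.+1 * E = W * (k.+1%:R * W ^+ k * E)); last first.
    by rewrite exprS; ring.
  by rewrite ler_wpM2r// !mulr_ge0// exprn_ge0.
have -> : c1 * A12 - c2 * A2 = list_sum c2 r2 k (fun s =>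
    c1 * \sum_(t <- r1) g (t :: s) - c2 * \sum_(t <- r2) g (t :: s)).
  rewrite /A12 /A2 /list_sum -!mulr_sumr exchange_big /= [X in c2 * (_ * X)]exchange_big /=.
  by rewrite sumrB -!mulr_sumr mulrBr !mulrA ![_ * c2 ^+ _]mulrC.
by apply: list_sum_le => // s sk; apply: (gE [::] s); rewrite /= sk.
Qed.

End Variation.

(** * Newton's identities and the discriminant as a Hankel determinant *)

Section PowerSums.

(** Synthetic division: comparing coefficients gives a two-term recurrence for those of [q], which
    telescopes because [q] has no coefficient at [m + N]. *)
Lemma coef_quotient_root (K : comNzRingType) (P q : {poly K}) (x : K) m N :
  P = q * ('X - x%:P) -> (size q <= m + N)%N ->
  q`_m = \sum_(0 <= i < N) P`_(m.+1 + i) * x ^+ i.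
Proof.
move=> PE sq.
have c l : P`_l.+1 = q`_l - x * q`_l.+1.
  by rewrite PE mulrBr coefB coefMX coefMC /= mulrC.
transitivity (- \sum_(0 <= i < N) (x ^+ i.+1 * q`_(m + i.+1) - x ^+ i * q`_(m + i))).
  rewrite (@telescope_sumr _ 0 N (fun i => x ^+ i * q`_(m + i)))//.
  by rewrite addn0 mul1r (nth_default _ sq) mulr0 sub0r opprK.
rewrite -sumrN; apply: eq_bigr => i _.
by rewrite addSn c exprS addnS; ring.
Qed.

Definition power_sum (K : pzRingType) (r : seq K) (k : nat) : K :=
  \sum_(x <- r) x ^+ k.

(** The [q i] are the products with one factor omitted. Only their factorisation property is kept,
    as this is what [coef_quotient_root] takes. *)
Lemma deriv_prod_XsubC (K : comNzRingType) (r : seq K) :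
  exists q : nat -> {poly K},
    (\prod_(x <- r) ('X - x%:P))^`() = \sum_(i < size r) q i /\
    forall i, (i < size r)%N ->
      \prod_(x <- r) ('X - x%:P) = q i * ('X - (r`_i)%:P).
Proof.
elim: r => [|y r [q [dq hq]]].
  by exists (fun=> 0); split=> //; rewrite big_nil big_ord0 derivC.
exists (fun i => if i is j.+1 then q j * ('X - y%:P)
                 else \prod_(x <- r) ('X - x%:P)); split.
  rewrite big_cons derivM derivB derivX derivC subr0 mul1r big_ord_recl /=.
  by rewrite dq -mulr_suml mulrC; congr (_ + _).
rewrite big_cons => -[|i] ir /=; first by rewrite mulrC.
by rewrite (hq i)// mulrCA mulrA.
Qed.

(** The derivative of [P] is the sum over the roots of the quotients of [P] by [X - x];
    [coef_quotient_root] expands each quotient. *)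
Lemma newton_deriv (K : idomainType) (P : {poly K}) (a : K) (r : seq K) m N :
  P = a *: \prod_(x <- r) ('X - x%:P) -> (size P <= (m + N).+1)%N ->
  P`_m.+1 *+ m.+1 = \sum_(0 <= i < N) P`_(m.+1 + i) * power_sum r i.
Proof.
move=> PE sP; rewrite -coef_deriv {1}PE derivZ.
have [q [-> hq]] := deriv_prod_XsubC r.
have Pq i : (i < size r)%N -> P = (a *: q i) * ('X - (r`_i)%:P).
  by move=> ir; rewrite -scalerAl -hq.
rewrite scaler_sumr coef_sum.
transitivity (\sum_(i < size r) \sum_(0 <= j < N) P`_(m.+1 + j) * r`_i ^+ j).
  apply: eq_bigr => i _; apply: coef_quotient_root; first exact: Pq.
  have [->|q0] := eqVneq (a *: q i) 0; first by rewrite size_poly0.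
  rewrite -ltnS; apply: leq_trans sP; rewrite {1}(Pq i)//.
  by rewrite size_Mmonic ?monicXsubC// size_XsubC addn2.
rewrite exchange_big /=; apply: eq_bigr => j _.
by rewrite -mulr_sumr /power_sum (big_nth 0 (r := r)) big_mkord.
Qed.

Lemma newton_roots (K : comNzRingType) (P : {poly K}) (r : seq K) k N :
  (forall x, x \in r -> root P x) -> (size P <= N)%N ->
  \sum_(0 <= i < N) P`_i * power_sum r (k + i) = 0.
Proof.
move=> rP sP; under eq_bigr do rewrite /power_sum mulr_sumr.
rewrite exchange_big /= big_seq big1// => x xr.
under eq_bigr do rewrite exprD mulrCA.
by rewrite -mulr_sumr big_mkord -(horner_coef_wide _ sP) (rootP (rP x xr)) mulr0.
Qed.

(** Both ranges of Newton's identities in one formula: [newton_deriv] gives [k < n], [newton_roots]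
    gives [k >= n]. In the second range the truncated [n - k] is [0] and removes the first term,
    while the [if] discards the negative indices. *)
Lemma power_sum_rec (K : idomainType) (P : {poly K}) (a : K) (r : seq K) k :
  let n := size r in
  P = a *: \prod_(x <- r) ('X - x%:P) ->
  a * power_sum r k = P`_(n - k) *+ (n - k) -
    \sum_(0 <= i < k) (if (n + i < k)%N then 0 else P`_(n + i - k)) * power_sum r i.
Proof.
move=> n PE.
have sP : (size P <= n.+1)%N.
  by rewrite PE (leq_trans (size_scale_leq _ _))// size_prod_XsubC.
have Pn : P`_n = a.
  have := monic_prod_XsubC r predT id; rewrite monicE lead_coefE size_prod_XsubC /= => /eqP h.
  by rewrite PE coefZ h mulr1.
have [kn|nk] := ltnP k n.
  have -> : (n - k = (n - k.+1).+1)%N by lia.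
  rewrite (newton_deriv (N := k.+1) PE); last by lia.
  rewrite big_nat_recr//= (_ : ((n - k.+1).+1 + k = n)%N); last by lia.
  rewrite Pn addrAC [X in X + _](_ : _ = 0) ?add0r//; apply/eqP; rewrite subr_eq0; apply/eqP.
  apply: eq_big_nat => i ik; case: ltnP => ?; first by lia.
  by congr (P`_ _ * _); lia.
rewrite (_ : (n - k)%N = 0%N); last by lia.
rewrite mulr0n sub0r.
apply/eqP; rewrite -addr_eq0 addrC; apply/eqP.
have := @newton_roots _ P r (k - n) n.+1; rewrite big_nat_recr//= Pn.
rewrite (_ : (k - n + n)%N = k); last by lia.
move=> NR; rewrite -[RHS]NR//; last first.
  move=> x xr; rewrite PE /root hornerZ mulf_eq0; apply/orP; right.
  by rewrite -/(root _ x) root_prod_XsubC.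
congr (_ + _); rewrite [LHS](big_cat_nat (n := (k - n)%N))//=; last by lia.
rewrite [X in X + _]big_nat_cond [X in X + _]big1 ?add0r; last first.
  by move=> i /andP[? _]; rewrite ifT ?mul0r//; lia.
rewrite -{1}[(k - n)%N]add0n big_addn (_ : (k - (k - n))%N = n); last by lia.
apply: eq_big_nat => i ik; rewrite ifF; last by lia.
by congr (P`_ _ * power_sum _ _); lia.
Qed.

(** The Vandermonde matrix times its transpose is the Hankel matrix of the power sums. *)
Lemma prod_sqr_diff_power_sum (K : comPzRingType) (r : seq K) n : size r = n ->
  prod_sqr_diff r = \det (\matrix_(i < n, j < n) power_sum r (i + j)).
Proof.
move=> <-{n}; rewrite prod_sqr_diff_det expr2 -{2}det_tr -det_mulmx; congr (\det _).
apply/matrixP => i j; rewrite !mxE /power_sum (big_nth 0) big_mkord.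
by apply: eq_bigr => k _; rewrite !mxE exprD.
Qed.

End PowerSums.

(** * Sign changes of a real polynomial along the integers *)

Section SignVariation.
Variable R : realType.
Implicit Types p : {poly R}.

Lemma sum_le_roots p (P : pred nat) (D : nat -> R -> Prop) M : p != 0 ->
  (forall i, P i -> exists2 x : R, root p x & D i x) ->
  (forall i j x, D i x -> D j x -> i = j) ->
  \sum_(0 <= i < M) (P i)%:R <= (size p)%:R :> R.
Proof.
move=> p0 Px Dinj.
have /choice[f fP] : forall i, exists x : R, P i -> root p x /\ D i x.
  move=> i; case: (boolP (P i)) => [/Px[x rx xi]|_]; first by exists x.
  by exists 0.
rewrite -natr_sum ler_nat -big_mkcond /= sum1_count -size_filter -(size_map f).
apply/ltnW/max_poly_roots => //.
  by rewrite all_map; apply/allP => i; rewrite mem_filter => /andP[/fP[rx _] _].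
rewrite map_inj_in_uniq ?filter_uniq ?iota_uniq// => i j.
rewrite !mem_filter => /andP[/fP[_ Di] _] /andP[/fP[_ Dj] _] fij.
by apply: Dinj Di _; rewrite fij.
Qed.

(** The one elementary test to which every condition on a line is reduced; applied to both [p] and
    [-p] it also expresses vanishing. *)
Definition nonpos p (t : int) : bool := p.[t%:~R] <= 0.

(** Each change of the test forces a root between consecutive integers. Rises and falls are counted
    separately: the root lies in [[i, i+1)] for a rise and in [(i, i+1]] for a fall, so within each
    kind distinct changes give distinct roots. *)
Lemma variation_nonpos p (t : int) M :
  seq_variation (fun i => (nonpos p (t + i%:Z))%:R : R) M <= (2 * size p)%:R.
Proof.
have [->|p0] := eqVneq p 0.
  by rewrite /seq_variation big1// => i _; rewrite /nonpos !horner0 lexx subrr normr0.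
pose up i := nonpos p (t + i%:Z) && ~~ nonpos p (t + i.+1%:Z).
pose down i := ~~ nonpos p (t + i%:Z) && nonpos p (t + i.+1%:Z).
have le01 i : (t + i%:Z)%:~R <= (t + i.+1%:Z)%:~R :> R by rewrite ler_int; lia.
have -> : seq_variation (fun i => (nonpos p (t + i%:Z))%:R : R) M =
    \sum_(0 <= i < M) (up i)%:R + \sum_(0 <= i < M) (down i)%:R.
  rewrite -big_split; apply: eq_bigr => i _; rewrite /= /up /down.
  by do 2 case: nonpos => /=; rewrite ?subrr ?sub0r ?subr0 ?normrN ?normr1 ?normr0 ?addr0 ?add0r.
rewrite mul2n -addnn natrD; apply: lerD.
  apply: (@sum_le_roots _ _
      (fun i x => (t + i%:Z)%:~R <= x < (t + i.+1%:Z)%:~R)) => //; last first.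
    move=> i j x /andP[i1 i2] /andP[j1 j2].
    by have := le_lt_trans i1 j2; have := le_lt_trans j1 i2; rewrite !ltr_int; lia.
  move=> i /andP[]; rewrite /nonpos -ltNge => h0 h1.
  have [|x] := @polyrcf.poly_ivt _ p _ _ (le01 i); first by rewrite mulr_le0_ge0// ltW.
  rewrite in_itv /= => /andP[x0 x1] rx; exists x => //.
  rewrite x0 lt_neqAle x1 andbT /=; apply: contraTneq h1 => <-.
  by rewrite (rootP rx) ltxx.
apply: (@sum_le_roots _ _
    (fun i x => (t + i%:Z)%:~R < x <= (t + i.+1%:Z)%:~R)) => //; last first.
  move=> i j x /andP[i1 i2] /andP[j1 j2].
  by have := lt_le_trans i1 j2; have := lt_le_trans j1 i2; rewrite !ltr_int; lia.
move=> i /andP[]; rewrite /nonpos -ltNge => h0 h1.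
have [|x] := @polyrcf.poly_ivt _ p _ _ (le01 i); first by rewrite mulr_ge0_le0// ltW.
rewrite in_itv /= => /andP[x0 x1] rx; exists x => //.
rewrite x1 lt_neqAle x0 !andbT; apply: contraTneq h0 => ->.
by rewrite (rootP rx) ltxx.
Qed.

End SignVariation.

(** * Functions of the coefficients that are polynomial on axis-parallel lines *)

Section PolynomialOnLines.
Variables (R : realType) (n : nat).
Implicit Types F G : seq int -> R[i].

(* The bound [d] is uniform over all lines of [Z^(n+1)] parallel to an axis;
   where [s`_n = 0] the degree drops and nothing is required. *)
Definition poly_on_lines F := exists d, forall s1 s2 : seq int,
  (size s1 + size s2)%N = n ->
  exists2 p : {poly R}, (size p <= d)%N & forall t : int,
    (s1 ++ t :: s2)`_n != 0 -> F (s1 ++ t :: s2) = (p.[t%:~R])%:C%C.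

Lemma eq_poly_on_lines F G :
  poly_on_lines F ->
  (forall s, size s = n.+1 -> s`_n != 0 -> F s = G s) -> poly_on_lines G.
Proof.
move=> [d hd] FG; exists d => s1 s2 ss; have [p pd hp] := hd s1 s2 ss.
exists p => // t t0; rewrite -FG ?hp//.
by rewrite size_cat /= addnS ss.
Qed.

Lemma poly_on_lines_const (c : R) : poly_on_lines (fun=> c%:C%C).
Proof.
exists 1%N => s1 s2 _; exists c%:P; first exact: size_polyC_leq1.
by move=> t _; rewrite hornerC.
Qed.

Lemma poly_on_lines_int (z : int) : poly_on_lines (fun=> z%:~R).
Proof.
apply: (eq_poly_on_lines (poly_on_lines_const z%:~R)) => s _ _.
exact: rmorph_int.
Qed.

Lemma nth_line_poly k (s1 s2 : seq int) : exists2 p : {poly R},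
  (size p <= 2)%N & forall t : int, ((s1 ++ t :: s2)`_k)%:~R = p.[t%:~R].
Proof.
have [k1|k1] := ltnP k (size s1).
  exists (s1`_k)%:~R%:P; first by rewrite (leq_trans (size_polyC_leq1 _)).
  by move=> t; rewrite hornerC nth_cat k1.
case kE : (k - size s1)%N => [|l].
  exists 'X; first by rewrite size_polyX.
  by move=> t; rewrite hornerX nth_cat ltnNge k1 kE.
exists (s2`_l)%:~R%:P; first by rewrite (leq_trans (size_polyC_leq1 _)).
by move=> t; rewrite hornerC nth_cat ltnNge k1 kE.
Qed.

Lemma poly_on_lines_coef k : poly_on_lines (fun s => (s`_k)%:~R).
Proof.
exists 2%N => s1 s2 _; have [p p2 hp] := nth_line_poly k s1 s2.
by exists p => // t _; rewrite -hp [RHS]rmorph_int.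
Qed.

Lemma poly_on_linesD F G : poly_on_lines F -> poly_on_lines G ->
  poly_on_lines (fun s => F s + G s).
Proof.
move=> [d hd] [e he]; exists (maxn d e) => s1 s2 ss.
have [p pd hp] := hd s1 s2 ss; have [q qe hq] := he s1 s2 ss.
exists (p + q).
  by rewrite (leq_trans (size_polyD _ _))// geq_max !leq_max pd qe orbT.
by move=> t t0; rewrite hp// hq// hornerD [RHS]rmorphD.
Qed.

Lemma poly_on_linesM F G : poly_on_lines F -> poly_on_lines G ->
  poly_on_lines (fun s => F s * G s).
Proof.
move=> [d hd] [e he]; exists (d + e)%N => s1 s2 ss.
have [p pd hp] := hd s1 s2 ss; have [q qe hq] := he s1 s2 ss.
exists (p * q).
  by rewrite (leq_trans (size_polyMleq _ _))// (leq_trans (leq_pred _))// leq_add.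
by move=> t t0; rewrite hp// hq// hornerM [RHS]rmorphM.
Qed.

Lemma poly_on_linesB F G : poly_on_lines F -> poly_on_lines G ->
  poly_on_lines (fun s => F s - G s).
Proof.
move=> hF hG; apply: (eq_poly_on_lines
  (poly_on_linesD hF (poly_on_linesM (poly_on_lines_int (-1)) hG))) => s _ _.
by rewrite mulN1r.
Qed.

Lemma poly_on_lines_sum (I : eqType) (r : seq I) (F : I -> seq int -> R[i]) :
  (forall i, i \in r -> poly_on_lines (F i)) ->
  poly_on_lines (fun s => \sum_(i <- r) F i s).
Proof.
elim: r => [_|i r IH hF].
  by apply: (eq_poly_on_lines (poly_on_lines_int 0)) => s _ _; rewrite big_nil.
apply: (eq_poly_on_lines (poly_on_linesD (hF i _) (IH _))).
- exact: mem_head.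
- by move=> j jr; apply: hF; rewrite inE jr orbT.
- by move=> s _ _; rewrite big_cons.
Qed.

Lemma poly_on_lines_prod (I : Type) (r : seq I) (F : I -> seq int -> R[i]) :
  (forall i, poly_on_lines (F i)) ->
  poly_on_lines (fun s => \prod_(i <- r) F i s).
Proof.
move=> hF; elim: r => [|i r IH].
  by apply: (eq_poly_on_lines (poly_on_lines_int 1)) => s _ _; rewrite big_nil.
by apply: (eq_poly_on_lines (poly_on_linesM (hF i) IH)) => s _ _; rewrite big_cons.
Qed.

Lemma poly_on_linesX F k : poly_on_lines F -> poly_on_lines (fun s => F s ^+ k).
Proof.
move=> hF; apply: (eq_poly_on_lines (poly_on_lines_prod (index_iota 0 k) (fun=> hF))).
by move=> s _ _; rewrite prodr_const_nat subn0.
Qed.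

Lemma poly_on_lines_det m (A : seq int -> 'M[R[i]]_m) :
  (forall i j, poly_on_lines (fun s => A s i j)) ->
  poly_on_lines (fun s => \det (A s)).
Proof.
move=> hA; suff: poly_on_lines (fun s => \sum_(sg : {perm 'I_m})
    ((-1) ^+ sg)%:~R * \prod_i A s i (sg i)).
  move/eq_poly_on_lines; apply=> s _ _.
  by apply: eq_bigr => sg _; rewrite rmorph_sign.
apply: poly_on_lines_sum => sg _; apply: poly_on_linesM.
  exact: poly_on_lines_int.
exact: poly_on_lines_prod.
Qed.

Lemma size_Poly_list (s : seq int) : size s = n.+1 -> s`_n != 0 ->
  size (Poly s) = n.+1.
Proof.
move=> ss sn; suff /PolyK -> : last 0 s != 0 by [].
by case: s ss sn => // t s [<-]; rewrite nth_last.
Qed.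

Lemma lead_coef_Poly_list (s : seq int) : size s = n.+1 -> s`_n != 0 ->
  lead_coef (Poly s) = s`_n.
Proof. by move=> ss sn; rewrite lead_coefE size_Poly_list// coef_Poly. Qed.

Lemma poly_on_lines_power_sum k :
  poly_on_lines (fun s => (s`_n)%:~R ^+ k * power_sum (croots R (Poly s)) k).
Proof.
elim/ltn_ind: k => k IH.
have sz s : size s = n.+1 -> s`_n != 0 -> size (croots R (Poly s)) = n.
  move=> ss sn; rewrite size_croots ?size_Poly_list//.
  by rewrite -size_poly_eq0 size_Poly_list.
case: k IH => [_|k IH].
  apply: (eq_poly_on_lines (poly_on_lines_int n)) => s ss sn.
  by rewrite mul1r -[LHS]/(n%:R) -{1}(sz s ss sn) -sum1_size natr_sum.
pose c i (s : seq int) : R[i] := if (n + i < k.+1)%N then 0 else (s`_(n + i - k.+1))%:~R.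
(* The recurrence multiplied by [a ^ k], where [a] is the leading coefficient: in the [i]-th term
   [a ^ k] splits as [a ^ (k - i)] times the [a ^ i] required by the induction hypothesis. *)
suff: poly_on_lines (fun s => (s`_n)%:~R ^+ k * (s`_(n - k.+1))%:~R * (n - k.+1)%N%:~R
  - \sum_(i <- index_iota 0 k.+1) c i s * (s`_n)%:~R ^+ (k - i) *
       ((s`_n)%:~R ^+ i * power_sum (croots R (Poly s)) i)).
  move/eq_poly_on_lines; apply=> s ss sn; have PE := crootsE R (Poly s).
  have := power_sum_rec k.+1 PE; rewrite sz// lead_coef_Poly_list// => rec.
  rewrite [in RHS]exprSr -[RHS]mulrA rec.
  rewrite mulrBr coef_map coef_Poly /= -mulrA -mulr_natr; congr (_ - _).
  rewrite mulr_sumr; apply: eq_big_nat => i /andP[_ ik].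
  rewrite coef_map coef_Poly /= !mulrA [_ ^+ k * _]mulrC /c.
  by rewrite -[in LHS](mulrA (if _ then _ else _)) -exprD subnK.
apply: poly_on_linesB.
  apply: poly_on_linesM; last exact: poly_on_lines_int.
  apply: poly_on_linesM; last exact: poly_on_lines_coef.
  exact/poly_on_linesX/poly_on_lines_coef.
apply: poly_on_lines_sum => i; rewrite mem_index_iota => /andP[_ ik].
apply: poly_on_linesM; last exact: IH.
apply: poly_on_linesM; last exact/poly_on_linesX/poly_on_lines_coef.
by rewrite /c; case: (_ < _)%N; [exact: poly_on_lines_int 0 | exact: poly_on_lines_coef].
Qed.

Lemma poly_on_lines_discriminant : poly_on_lines (fun s =>
  (s`_n)%:~R ^+ (2 * n * n) * discriminantC R (Poly s)).
Proof.
pose A (s : seq int) : 'M[R[i]]_n := \matrix_(i, j) ((s`_n)%:~R ^+ (2 * n) *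
  power_sum (croots R (Poly s)) (i + j)).
suff: poly_on_lines (fun s => (s`_n)%:~R ^+ (2 * n - 2) * \det (A s)).
  move/eq_poly_on_lines; apply=> s ss sn; rewrite /discriminantC lead_coef_Poly_list// size_Poly_list//=.
  rewrite (@prod_sqr_diff_power_sum _ _ n); last first.
    by rewrite size_croots ?size_Poly_list// -size_poly_eq0 size_Poly_list.
  rewrite [RHS]mulrCA; congr (_ * _).
  (* A factor [a ^ (2n)] goes into each entry of the [n] by [n] determinant; it suffices there
     because [i + j <= 2n]. *)
  rewrite exprM -detZ; congr (\det _); apply/matrixP => i j.
  by rewrite !mxE.
apply: poly_on_linesM; first exact/poly_on_linesX/poly_on_lines_coef.
apply: poly_on_lines_det => i j.
apply: (eq_poly_on_lines (poly_on_linesM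
  (poly_on_linesX (2 * n - (i + j)) (poly_on_lines_coef n))
  (poly_on_lines_power_sum (i + j)))) => s _ _.
by rewrite mxE mulrA -exprD subnK//; have := ltn_ord i; have := ltn_ord j; lia.
Qed.

End PolynomialOnLines.

(** * Bounded variation of the indicator of the event on lines *)

Section Indicator.
Variables (R : realType) (n : nat).

(** Lists of [n + 1] integers stand for coefficient vectors; a nonzero last entry means degree
    exactly [n]. *)
Definition indicator (A : {poly int} -> bool) (s : seq int) : R :=
  ((s`_n != 0) && A (Poly s))%:R.

Definition disc_between (c : R) (a b : \bar R) (P : {poly int}) : bool :=
  (a <= (discriminant R P / c)%:E <= b)%E.

Lemma discriminant_on_lines : exists d, forall s1 s2 : seq int,
  (size s1 + size s2)%N = n ->
  exists2 p : {poly R}, (size p <= d)%N & forall t : int,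
    let s := s1 ++ t :: s2 in s`_n != 0 ->
    (s`_n)%:~R ^+ (2 * n * n) * discriminant R (Poly s) = p.[t%:~R].
Proof.
have [d hd] := poly_on_lines_discriminant R n.
exists d => s1 s2 ss; have [p pd hp] := hd s1 s2 ss; exists p => // t s s0.
apply: complexI; rewrite -hp// [LHS]rmorphM rmorphXn rmorph_int.
congr (_ * _); rewrite discriminantC_real//.
rewrite -size_poly_eq0 (@size_Poly_list n)//.
by rewrite size_cat /= addnS ss.
Qed.

(** On a line the event is a conjunction of sign conditions on polynomials whose sizes depend on [n]
    only, whence a bound uniform in [c], [a] and [b]. This uniformity is what later allows every
    [m]. *)
Lemma indicator_seq_variation : exists K : R, 0 <= K /\
  forall (c : R) (a b : \bar R) (s1 s2 : seq int) (t : int) M, 0 < c ->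
    (size s1 + size s2)%N = n ->
    seq_variation (fun i => indicator (disc_between c a b) (s1 ++ (t + i%:Z) :: s2)) M
      <= K.
Proof.
have [d hd] := discriminant_on_lines.
pose e := (2 * n * n)%N; pose D := maxn d (e.+1).
(* Two tests on the leading coefficient [q] and [-q], of size at most 2, and one for each endpoint,
   of size at most [D]; [variation_nonpos] doubles each size. *)
exists (2 * 2 + 2 * 2 + 2 * D + 2 * D)%:R; split=> // c a b s1 s2 t M c0 ss.
have [q q2 hq] := nth_line_poly R n s1 s2.
have [p pd hp] := hd s1 s2 ss.
have sqe x : (size (x *: q ^+ e)%R <= D)%N.
  rewrite (leq_trans (size_scale_leq _ _))// (leq_trans (size_poly_exp_leq _ _))//.
  rewrite leq_max; apply/orP; right; rewrite ltnS -[leqRHS]mul1n leq_mul2r.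
  by case: (size q) q2 => [|[|[]]]; rewrite ?orbT.
have pD : (size p <= D)%N by rewrite leq_max pd.
have oneD : (size (1 : {poly R})%R <= D)%N by rewrite size_poly1 leq_max orbT.
have zeroD : (size (0 : {poly R})%R <= D)%N by rewrite size_poly0.
(* The exponent [e] is even, so multiplying an inequality by [q ^ e] keeps its direction whatever
   the sign of the leading coefficient. *)
have qe0 u : q.[u%:~R] != 0 -> 0 < q.[u%:~R] ^+ e :> R.
  move=> q0; rewrite /e -mulnA exprM exprn_gt0// exprn_even_gt0//.
pose f u := discriminant R (Poly (s1 ++ u :: s2)) / c.
have fE u : q.[u%:~R] != 0 -> p.[u%:~R] = q.[u%:~R] ^+ e * (f u * c).
  have /= := hp u; rewrite -(intr_eq0 R) hq => hpu q0.
  by rewrite /f divfK ?gt_eqF// hpu.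
(* A finite endpoint is cleared of denominators by [c * q ^ e]. For an infinite one, the constant
   [0] encodes a test that always holds and [1] one that never does. *)
have [p1 p1D hp1] : exists2 p1 : {poly R}, (size p1 <= D)%N & forall u,
    q.[u%:~R] != 0 -> (a <= (f u)%:E)%E = nonpos p1 u.
  case: a => [x||].
  - exists ((x * c) *: q ^+ e - p).
      by rewrite (leq_trans (size_polyD _ _))// geq_max sqe size_polyN.
    move=> u q0; rewrite lee_fin /nonpos hornerD hornerN hornerZ horner_exp subr_le0.
    by rewrite fE// (mulrC (x * c)) ler_pM2l ?qe0// ler_pM2r.
  - exists 1 => // u _; rewrite /nonpos hornerC ler10.
    by apply/negbTE; rewrite -ltNge ltry.
  - by exists 0 => // u _; rewrite /nonpos horner0 lexx leNye.
have [p2 p2D hp2] : exists2 p2 : {poly R}, (size p2 <= D)%N & forall u,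
    q.[u%:~R] != 0 -> ((f u)%:E <= b)%E = nonpos p2 u.
  case: b => [x||].
  - exists (p - (x * c) *: q ^+ e).
      by rewrite (leq_trans (size_polyD _ _))// geq_max size_polyN sqe pD.
    move=> u q0; rewrite lee_fin /nonpos hornerD hornerN hornerZ horner_exp subr_le0.
    by rewrite fE// (mulrC (x * c)) ler_pM2l ?qe0// ler_pM2r.
  - by exists 0 => // u _; rewrite /nonpos horner0 lexx leey.
  - exists 1 => // u _; rewrite /nonpos hornerC ler10.
    by apply/negbTE; rewrite -ltNge ltNyr.
pose I (r : {poly R}) i : R := (nonpos r (t + i%:Z))%:R.
have I01 r i : 0 <= I r i <= 1 by rewrite /I; case: nonpos; rewrite lexx ler01.
have IM (H G : nat -> R) : (forall i, 0 <= H i <= 1) -> (forall i, 0 <= G i <= 1) ->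
    forall i, 0 <= H i * G i <= 1.
  move=> H01 G01 i; have /andP[h0 h1] := H01 i; have /andP[g0 g1] := G01 i.
  by rewrite mulr_ge0 // mulr_ile1.
pose Z i : R := 1 - I q i * I (- q) i.
have Z01 i : 0 <= Z i <= 1.
  by have /andP[h0 h1] := IM _ _ (I01 q) (I01 (- q)) i; rewrite /Z subr_ge0 h1 gerBl h0.
have -> : seq_variation (fun i => indicator (disc_between c a b) (s1 ++ (t + i%:Z) :: s2)) M
   = seq_variation (fun i => Z i * I p1 i * I p2 i) M.
  congr seq_variation; apply/funext => i; rewrite /Z /I /indicator /disc_between.
  rewrite -(intr_eq0 R) hq; set u := t + i%:Z.
  have -> : 1 - (nonpos q u)%:R * (nonpos (- q) u)%:R = (q.[u%:~R] != 0)%:R :> R.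
    rewrite -natrM mulnb /nonpos hornerN oppr_le0 -eq_le.
    by case: eqP; rewrite /= ?subrr ?subr0.
  case: eqP => [|/eqP q0]; first by rewrite !mul0r.
  by rewrite mul1r -natrM mulnb -/(f u) hp1// hp2.
have vI (r : {poly R}) : (size r <= D)%N -> seq_variation (I r) M <= (2 * D)%:R.
  move=> rD; apply: le_trans (variation_nonpos r t M) _.
  by rewrite ler_nat leq_mul2l.
have vI2 (r : {poly R}) : (size r <= 2)%N -> seq_variation (I r) M <= (2 * 2)%:R.
  move=> rD; apply: le_trans (variation_nonpos r t M) _.
  by rewrite ler_nat leq_mul2l.
have vZ : seq_variation Z M = seq_variation (fun i => I q i * I (- q) i) M.
  apply: eq_bigr => i _; rewrite /Z -normrN; congr (`| _ |); ring.
rewrite natrD [(_ + 2 * D)%:R]natrD [(_ + 2 * 2)%:R]natrD.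
apply: le_trans (seq_variationM _ (IM _ _ Z01 (I01 p1)) (I01 p2)) _.
apply: lerD; last exact: vI.
apply: le_trans (seq_variationM _ Z01 (I01 p1)) _.
apply: lerD; last exact: vI.
rewrite vZ; apply: le_trans (seq_variationM _ (I01 q) (I01 (- q))) _.
by apply: lerD; apply: vI2; rewrite ?size_polyN.
Qed.

End Indicator.

(** * Counting polynomials of bounded height *)

Section Counting.
Variables (R : realType) (n : nat).
Implicit Types (Q : R) (A : {poly int} -> bool).

Definition height_bound Q : nat := absz (Num.floor Q).

Lemma height_bound_floor Q : 0 <= Q -> (height_bound Q)%:Z = Num.floor Q.
Proof. by move=> Q0; rewrite /height_bound abszE ger0_norm// floor_ge_int. Qed.

Lemma height_boundP Q (x : int) : 0 <= Q ->
  (`|x| <= (height_bound Q)%:Z) = (`|x|%:~R <= Q).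
Proof. by move=> Q0; rewrite height_bound_floor// floor_ge_int. Qed.

Lemma height_bound_itv Q : 0 <= Q -> (height_bound Q)%:R <= Q < (height_bound Q).+1%:R.
Proof.
move=> Q0; have := floor_itv Q.
by rewrite intrD -height_bound_floor// -natr1.
Qed.

Definition count Q A : R :=
  \sum_(s <- lists (ints (height_bound Q)) n.+1) indicator R n A s.

(** [Poly] is injective on lists of equal length, and lists with nonzero last entry give exactly the
    polynomials of degree [n]. *)
Lemma card_intpolys Q A : 0 <= Q ->
  #|` fset_set (intpolys n Q `&` [set P | A P])%classic |%:R = count Q A.
Proof.
move=> Q0; rewrite /count; set l := lists _ _.
pose r := [seq s <- l | (s`_n != 0) && A (Poly s)].
have sl s : s \in l -> size s = n.+1 by rewrite mem_lists => /andP[/eqP].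
have -> : fset_set (intpolys n Q `&` [set P | A P])%classic =
    [fset P in map (@Poly int) r]%fset.
  apply/fsetP => P; rewrite in_fset_set; last exact/finite_setIl/finite_intpolys.
  rewrite inE; apply/idP/mapP.
    rewrite inE => -[[sP hP] AP]; exists (polyseq P); last by rewrite polyseqK.
    rewrite mem_filter polyseqK AP andbT mem_lists sP eqxx /=.
    have -> : P`_n = lead_coef P by rewrite lead_coefE sP.
    rewrite lead_coef_eq0 -size_poly_gt0 sP /=; apply/allP => x /(nthP 0)[k]; rewrite sP ltnS => kn <-.
    by rewrite /= mem_ints height_boundP// hP.
  move=> [s]; rewrite mem_filter => /andP[/andP[sn As] ls] ->.
  rewrite inE; split=> //; have ss := sl s ls.
  split; first exact: size_Poly_list.
  move=> k kn; rewrite coef_Poly -height_boundP// -mem_ints.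
  by move: ls; rewrite mem_lists => /andP[_ /allP]; apply; apply: mem_nth; rewrite ss.
rewrite card_fseq undup_id; last first.
  rewrite map_inj_in_uniq ?filter_uniq ?lists_uniq ?ints_uniq// => s s'.
  rewrite !mem_filter => /andP[_ /sl ss] /andP[_ /sl ss'] PP.
  apply: (@eq_from_nth _ 0); rewrite ss ?ss'// => i _.
  by have := congr1 (fun p : {poly int} => p`_i) PP; rewrite /= !coef_Poly.
rewrite size_map size_filter -sum1_count natr_sum big_mkcond /=.
by apply: eq_bigr => s _; rewrite /indicator; case: (_ && _).
Qed.

Lemma count_ge0 Q A : 0 <= count Q A.
Proof. exact: sumr_ge0. Qed.

Lemma le_count Q A : count Q A <= count Q xpredT.
Proof.
apply: ler_sum => s _; rewrite /indicator ler_nat andbT.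
by case: (_ != 0) => //=; case: (A _).
Qed.

Lemma sum_lists_last (r : seq int) (k : nat) :
  \sum_(s <- lists r k.+1) (s`_k != 0)%:R =
  (size r)%:R ^+ k * \sum_(t <- r) (t != 0)%:R :> R.
Proof.
elim: k => [|k IH].
  by rewrite sum_listsS mul1r; apply: eq_bigr => t _; rewrite big_seq1.
rewrite sum_listsS; under eq_bigr do rewrite /= IH.
by rewrite big_const_seq count_predT iter_addr_0 -[LHS]mulr_natl mulrA exprS.
Qed.

Lemma count_total_ge Q : 1 < Q -> Q ^+ n.+1 <= count Q xpredT.
Proof.
move=> Q1; have Q0 : 0 <= Q by rewrite ltW// (lt_trans ltr01).
have /andP[_ LQ] := height_bound_itv Q0.
rewrite /count /indicator; under eq_bigr do rewrite andbT.
rewrite sum_lists_last; set L := height_bound Q in LQ *.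
(* With [L >= 1] one has [2L >= L + 1 > Q], so the nonzero leading coefficients alone number at
   least [Q]. *)
have L0 : (0 < L)%N.
  by case: L LQ => // /(lt_trans Q1); rewrite ltxx.
have -> : \sum_(t <- ints L) (t != 0)%:R = (2 * L)%:R :> R.
  rewrite -natr_sum -big_mkcond sum1_count; congr _%:R.
  have := count_predC (pred1 0) (ints L); rewrite count_uniq_mem ?ints_uniq//.
  rewrite mem_ints normr0 size_map size_iota => h.
  by apply/eq_add_S; rewrite -h.
rewrite exprSr; apply: ler_pM => //; first exact: exprn_ge0.
  rewrite lerXn2r ?nnegrE// size_map size_iota (le_trans (ltW LQ))// ler_nat; lia.
by rewrite (le_trans (ltW LQ))// ler_nat; lia.
Qed.

(** * Homogeneity of the discriminant and comparison of the heights [Q] and [m Q] *)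

Lemma Poly_scale (m : int) (s : seq int) : Poly (map ( *%R m) s) = m *: Poly s.
Proof.
apply/polyP => k; rewrite coefZ !coef_Poly.
by have [ks|ks] := ltnP k (size s);
   [rewrite (nth_map 0)|rewrite !nth_default ?size_map// mulr0].
Qed.

(** [P] and [m P] have the same roots, so only the power of the leading coefficient changes. *)
Lemma discriminant_scale (m : int) (P : {poly int}) : m != 0 -> P != 0 ->
  discriminant R (m *: P) =
  m%:~R ^+ (2 * (size P).-1 - 2) * discriminant R P.
Proof.
move=> m0 P0; apply: complexI.
have mP0 : m *: P != 0 by rewrite -mul_polyC mulf_neq0 ?polyC_eq0.
rewrite -discriminantC_real// [RHS]rmorphM rmorphXn rmorph_int /= -discriminantC_real//.
rewrite (@discriminantC_roots R _ (croots R P))//; last first.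
  rewrite lead_coefZ intrM -scalerA -crootsE -mul_polyC rmorphM /= map_polyC /=.
  by rewrite mul_polyC.
by rewrite lead_coefZ intrM exprMn size_scale// -mulrA.
Qed.

Lemma indicator_scale (c : R) (a b : \bar R) (m : nat) (s : seq int) : (0 < m)%N ->
  size s = n.+1 ->
  indicator R n (disc_between (m%:R ^+ (2 * n - 2) * c) a b) (map ( *%R m%:Z) s) =
  indicator R n (disc_between c a b) s.
Proof.
move=> m0 ss; rewrite /indicator (nth_map 0) ?ss// mulf_eq0 negb_or.
rewrite (_ : m%:Z != 0) ?(gt_eqF m0)//=; last by lia.
have [//|sn /=] := eqVneq s`_n 0.
rewrite /disc_between Poly_scale discriminant_scale; first last.
- by rewrite -size_poly_eq0 (size_Poly_list ss).
- by lia.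
rewrite (size_Poly_list ss)//= -mulf_div divff ?mul1r//.
by rewrite expf_neq0// pnatr_eq0 -lt0n.
Qed.

Lemma count_dist : exists K : R, 0 <= K /\
  forall (c Q : R) (a b : \bar R) (m : nat), 0 < c -> 1 < Q -> (0 < m)%N ->
    `|count (m%:R * Q) (disc_between (m%:R ^+ (2 * n - 2) * c) a b)
      - m%:R ^+ n.+1 * count Q (disc_between c a b)|
     <= K * m%:R ^+ n.+1 * Q ^+ n.
Proof.
have [K [K0 hK]] := indicator_seq_variation R n.
exists (n.+1%:R * 3%:R ^+ n * (K + 3%:R)); split.
  by rewrite !mulr_ge0 ?exprn_ge0 ?addr_ge0.
move=> c Q a b m c0 Q1 m0.
have Q0 : 0 <= Q by rewrite ltW// (lt_trans ltr01).
have m1 : 1 <= m%:R :> R by rewrite ler1n.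
have mpos : 0 < m%:R :> R by rewrite ltr0n.
have mQ0 : 0 <= m%:R * Q by rewrite mulr_ge0.
have mQ1 : 1 <= m%:R * Q by rewrite mulr_ege1// ltW.
have /andP[L1 L2] := height_bound_itv Q0.
have /andP[L'1 L'2] := height_bound_itv mQ0.
set L := height_bound Q in L1 L2; set L' := height_bound (_ * _) in L'1 L'2.
pose cm := m%:R ^+ (2 * n - 2) * c.
have cm0 : 0 < cm by rewrite mulr_gt0// exprn_gt0.
pose g := indicator R n (disc_between cm a b).
have -> : count (m%:R * Q) (disc_between cm a b) = list_sum 1 (ints L') n.+1 g.
  by rewrite /list_sum expr1n mul1r.
have -> : m%:R ^+ n.+1 * count Q (disc_between c a b) =
    list_sum m%:R (map ( *%R m%:Z) (ints L)) n.+1 g.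
  rewrite /list_sum map_lists big_map; congr (_ * _).
  rewrite /count !big_seq; apply: eq_bigr => s; rewrite mem_lists => /andP[/eqP ss _].
  by rewrite /g indicator_scale.
have LL : (m * L <= L')%N.
  rewrite -ltnS -(ltr_nat R); apply: le_lt_trans L'2.
  by rewrite natrM ler_pM2l.
have LL' : (L' < m * L.+1)%N.
  rewrite -(ltr_nat R); apply: le_lt_trans L'1 _.
  by rewrite natrM ltr_pM2l.
(* Here [W = 3 m Q] dominates both weighted line lengths [2L' + 1] and [m (2L + 1)], since [Q] and
   [m Q] are at least 1; [E] is the bound of [sum_ints_coarse]. *)
apply: le_trans (@list_sum_dist R 1 _ m%:R _ n.+1 g (m%:R * (K + 3%:R))
  (3%:R * (m%:R * Q)) _ _ _ _ _ _) _ => //.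
- by rewrite mulr_ge0// addr_ge0.
- rewrite mul1r size_map size_iota -natr1 natrM; lra.
- rewrite !size_map size_iota -natr1 natrM.
  apply: le_trans (_ : m%:R * (3%:R * Q) <= _); last by rewrite mulrCA.
  rewrite ler_pM2l//; lra.
- move=> s1 s2 [ss]; rewrite mul1r [X in _ - _ * X]big_map.
  apply: (@sum_ints_coarse R m L L' (fun t => g (s1 ++ t :: s2)) K) => //.
    by move=> t; rewrite /g /indicator ler0n lern1 leq_b1.
  by move=> t M; apply: hK.
- by rewrite /= !exprMn (exprS m%:R); rewrite le_eqVlt; apply/orP; left; apply/eqP; ring.
Qed.

Definition prob_between Q (a b : \bar R) : R := prob_intpolys n Q
  [set P | (a <= (discriminant R P / Q ^+ (2 * n - 2))%:E <= b)%E]%classic.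

Lemma prob_betweenE Q (a b : \bar R) : 0 <= Q ->
  prob_between Q a b =
  count Q (disc_between (Q ^+ (2 * n - 2)) a b) / count Q xpredT.
Proof.
move=> Q0; rewrite /prob_between /prob_intpolys -card_intpolys//; congr (_ / _).
rewrite -card_intpolys//; congr (#|` fset_set _ |%:R).
by rewrite -[LHS]setIT; congr (_ `&` _)%classic; apply/seteqP; split.
Qed.

Lemma disc_between_total (c : R) : disc_between c -oo%E +oo%E = xpredT.
Proof. by apply/funext => P; rewrite /disc_between leNye leey. Qed.

Lemma prob_dist : exists C : R, 0 < C /\
  forall (Q : R) (a b : \bar R) (m : nat), 1 < Q -> (0 < m)%N ->
  `|prob_between Q a b - prob_between (m%:R * Q) a b| <= C / Q.
Proof.
have [K [K0 hK]] := count_dist.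
exists (2 * K + 1); split; first by rewrite ltr_wpDl// mulr_ge0.
move=> Q a b m Q1 m0.
have Qgt : 0 < Q by rewrite (lt_trans ltr01).
have mpos : 0 < m%:R :> R by rewrite ltr0n.
have m1 : 1 <= m%:R :> R by rewrite ler1n.
have mQ1 : 1 < m%:R * Q by rewrite (lt_le_trans Q1)// ler_peMl// ltW.
rewrite distrC !prob_betweenE ?mulr_ge0 ?(ltW Qgt)// (exprMn _ m%:R).
have c0 : 0 < Q ^+ (2 * n - 2) by rewrite exprn_gt0.
(* The numerator and the denominator are compared by the same lemma; the denominator is the case of
   the whole extended line. *)
have h1 := hK _ Q a b m c0 Q1 m0; have h2 := hK _ Q -oo%E +oo%E m c0 Q1 m0.
rewrite !disc_between_total in h2.
set S' := count (m%:R * Q) _ in h1 *; set T' := count (m%:R * Q) _ in h2 *.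
set S := count Q _ in h1 *; set T := count Q _ in h2 *.
have T'0 : 0 < T' by apply: lt_le_trans (count_total_ge mQ1); rewrite exprn_gt0// (lt_trans ltr01).
have TQ : Q ^+ n.+1 <= T := count_total_ge Q1.
have T0 : 0 < T by apply: lt_le_trans TQ; rewrite exprn_gt0.
have S'0 : 0 <= S' := count_ge0 _ _.
have S'T' : S' <= T' := le_count _ _.
set mu := m%:R ^+ n.+1 in h1 h2 *.
have mu0 : 0 < mu by rewrite exprn_gt0.
(* As [S' / T' <= 1], the numerator is at most twice the bound of [count_dist], and
   [mu * T >= mu * Q ^ (n + 1)] leaves [2K / Q]. The extra 1 in the constant only makes it
   positive. *)
have -> : S' / T' - S / T =
   ((S' - mu * S) - S' / T' * (T' - mu * T)) / (mu * T).
  by field; rewrite !gt_eqF.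
rewrite normrM normfV (gtr0_norm (mulr_gt0 mu0 T0)).
rewrite ler_pdivrMr ?mulr_gt0//.
apply: le_trans (_ : 2 * (K * mu * Q ^+ n) <= _).
  apply: le_trans (ler_normB _ _) _; rewrite mulr2n mulrDl mul1r; apply: lerD => //.
  rewrite normrM ger0_norm ?divr_ge0 ?(ltW T'0)//; apply: le_trans h2.
  by rewrite ler_piMl// ler_pdivrMr// mul1r.
apply: le_trans (_ : (2 * K + 1) / Q * (mu * Q ^+ n.+1) <= _); last first.
  by rewrite ler_pM2l ?ler_pM2l// divr_gt0// ltr_wpDl// mulr_ge0.
rewrite exprS (_ : _ / Q * _ = (2 * K + 1) * mu * Q ^+ n); last by field; rewrite gt_eqF.
have : 0 <= mu * Q ^+ n by rewrite mulr_ge0 ?exprn_ge0// ltW.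
set z := mu * _ => z0; rewrite -!mulrA -/z mulrA ler_wpM2r// lerDl//.
Qed.

End Counting.

(** * Passage to the limit in [m] *)

Theorem mainTheorem4 (R : realType) (n : nat) (hn : (4 <= n)%N) :
  exists C : R, 0 < C /\
    forall phi : R -> R,
      (forall x : R, x != 0 -> {for x, continuous phi}) ->
      (exists C0 : R, 0 < C0 /\ forall Q : R, 1 < Q ->
         (discriminant_discrepancy n phi Q <= (C0 / ln Q)%:E)%E) ->
      forall Q : R, 1 < Q ->
        (discriminant_discrepancy n phi Q <= (C / Q)%:E)%E.
Proof.
have [C [C_gt0 hC]] := prob_dist R n.
exists C; split=> // phi _ [C0 [C0_gt0 hphi]] Q Q1.
apply: ge_ereal_sup => _ [a [b [ab ->]]].
apply/lee_addgt0Pr => eps eps0.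
have Q_gt0 : 0 < Q by rewrite (lt_trans ltr01).
(* Chosen so that [ln (m Q) >= C0 / eps], which makes the logarithmic bound at height [m Q] at most
   [eps]; [C] does not depend on [m]. *)
pose m := (absz (Num.floor (expR (C0 / eps)))).+1.
have mE : expR (C0 / eps) <= m%:R.
  have /andP[_ /ltW] := height_bound_itv (ltW (expR_gt0 (C0 / eps))); exact.
have m_gt0 : (0 < m)%N by [].
have mQ1 : 1 < m%:R * Q by rewrite (lt_le_trans Q1)// ler_peMl ?ler1n// ltW.
have lnmQ : C0 / eps <= ln (m%:R * Q).
  rewrite -[leLHS]expRK ler_ln ?posrE ?expR_gt0 ?mulr_gt0//.
  by rewrite (le_trans mE)// ler_peMr// ltW.
have C0eps : C0 / ln (m%:R * Q) <= eps.
  rewrite ler_pdivrMr; last by apply: lt_le_trans lnmQ; rewrite divr_gt0.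
  by rewrite mulrC -ler_pdivrMr.
have dp := hC Q a b m Q1 m_gt0; pose p Q := prob_between n Q a b.
have : (`|(p (m%:R * Q))%:E -
   \int[lebesgue_measure]_(x in [set x : R | (a <= x%:E <= b)%E]%classic) (phi x)%:E|
   <= eps%:E)%E.
  apply: le_trans (_ : (C0 / ln (m%:R * Q))%:E <= _)%E; last by rewrite lee_fin.
  apply: le_trans (hphi _ mQ1); apply: ereal_sup_ubound.
  by exists a, b.
rewrite -/(prob_between n Q a b) -/(p Q).
(* An infinite integral would make the distance at height [m Q] infinite, against the bound
   [eps]. *)
case: (integral _ _ _) => [I||] //=; rewrite -!EFinD !lee_fin.
move=> h; apply: le_trans (ler_distD (p (m%:R * Q)) _ _) _.
exact: lerD.
Qed.
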